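(* Let $P\subseteq\mathbb{R}^d$ be a $d$-dimensional convex lattice polytope (all vertices in $\mathbb{Z}^d$) that contains no point of $\mathbb{Z}^d$ in its interior and all of whose facets are simplices. Then $P$ has at most $2^d$ vertices.
   Context: A lattice polytope with no lattice points in its interior is called hollow; this result states that the maximum number of vertices of a hollow simplicial lattice polytope in $\mathbb{R}^d$ is at most $2^d$. *)

(* Defs.v *)
From HB Require Import structures.
From mathcomp Require Import all_boot all_order all_algebra.
From mathcomp Require Import all_classical all_reals all_analysis.
Set Implicit Arguments. Unset Strict Implicit. Unset Printing Implicit Defensive.
Import Order.TTheory GRing.Theory Num.Theory.
Local Open Scope ring_scope.
Local Open Scope classical_set_scope.

Definition conv_hull (R : realType) (d : nat) (V : seq 'rV[R]_d) : set 'rV[R]_d :=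
  [set x | exists l : 'I_(size V) -> R,
     [/\ forall i, 0 <= l i, \sum_i l i = 1 & x = \sum_i l i *: V`_i]].

Definition lattice_pt (R : realType) (d : nat) (x : 'rV[R]_d) : Prop :=
  forall i, x ord0 i \is a Num.int.

Definition dotp (R : realType) (d : nat) (a x : 'rV[R]_d) : R :=
  \sum_i a ord0 i * x ord0 i.

Definition aff_rank (R : realType) (d : nat) (F : seq 'rV[R]_d) : nat :=
  \rank (\matrix_(i < size F) (F`_i - F`_0)).

Definition vertex_set (R : realType) (d : nat) (V : seq 'rV[R]_d) : Prop :=
  uniq V /\ forall v, v \in V -> ~ conv_hull (rem v V) v.

(* F (a sublist of V) is the vertex list of a facet of the full-dimensional
   polytope conv_hull V: it is the set of vertices on a supporting hyperplane
   {a . x = b} (a <> 0, a . v <= b on V) and spans a (d-1)-dim affine space. *)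
Definition facet_vertices (R : realType) (d : nat) (V F : seq 'rV[R]_d) : Prop :=
  exists (a : 'rV[R]_d) (b : R),
    [/\ a != 0, (forall v, v \in V -> dotp a v <= b),
        F = [seq v <- V | dotp a v == b], F != [::] & aff_rank F = d.-1].

Definition aff_indep (R : realType) (d : nat) (F : seq 'rV[R]_d) : Prop :=
  F != [::] /\ aff_rank F = (size F).-1.

Definition simplicial (R : realType) (d : nat) (V : seq 'rV[R]_d) : Prop :=
  forall F, facet_vertices V F -> aff_indep F.

(* Main.v *)
(* A lattice point x of P lies on the boundary, hence on a facet; the facet
   being a simplex, x is a convex combination of V with unique weights W_x.
   Order the vertices as v_1, ..., v_n.  Among the lattice points x of P with
   W_x(v_i) > 0 and W_x(v_j) = 0 for j > i (v_i is one of them), let p_i be one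
   minimizing W_x(v_i).  If p_i and p_j, i < j, were congruent modulo 2, their
   midpoint would be a lattice point of P with v_j-weight W_{p_j}(v_j) / 2 and
   no weight on later vertices, against the choice of p_j.  So the p_i lie in
   n distinct classes modulo 2. *)
Require Import Defs.
From HB Require Import structures.
From mathcomp Require Import all_boot all_order all_algebra.
From mathcomp Require Import all_classical all_reals all_analysis.
From mathcomp Require Import zify lra.
Import Order.TTheory GRing.Theory Num.Theory.
Local Open Scope ring_scope.
Import numFieldNormedType.Exports.
Local Open Scope classical_set_scope.

(** * Theorems of the alternative for linear inequalities *)

Section LinearInequalities.
Context {R : realType} {d : nat}.
Implicit Types a b x y : 'rV[R]_d.

Lemma dotpE a x : dotp a x = (x *m a^T) ord0 ord0.
Proof. by rewrite /dotp mxE; apply: eq_bigr => i _; rewrite !mxE mulrC. Qed.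

Lemma dotpC a x : dotp a x = dotp x a.
Proof. by apply: eq_bigr => i _; rewrite mulrC. Qed.

Lemma dotpDr a x y : dotp a (x + y) = dotp a x + dotp a y.
Proof. by rewrite !dotpE mulmxDl mxE. Qed.

Lemma dotpZr a c x : dotp a (c *: x) = c * dotp a x.
Proof. by rewrite !dotpE -scalemxAl mxE. Qed.

Lemma dotpNr a x : dotp a (- x) = - dotp a x.
Proof. by rewrite -scaleN1r dotpZr mulN1r. Qed.

Lemma dotpBr a x y : dotp a (x - y) = dotp a x - dotp a y.
Proof. by rewrite dotpDr dotpNr. Qed.

Lemma dotpDl a b x : dotp (a + b) x = dotp a x + dotp b x.
Proof. by rewrite !(dotpC _ x) dotpDr. Qed.

Lemma dotpZl c a x : dotp (c *: a) x = c * dotp a x.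
Proof. by rewrite !(dotpC _ x) dotpZr. Qed.

Lemma dotpNl a x : dotp (- a) x = - dotp a x.
Proof. by rewrite !(dotpC _ x) dotpNr. Qed.

Lemma dotpBl a b x : dotp (a - b) x = dotp a x - dotp b x.
Proof. by rewrite !(dotpC _ x) dotpBr. Qed.

Lemma dotp_sumr a I (r : seq I) (P : pred I) (F : I -> 'rV[R]_d) :
  dotp a (\sum_(i <- r | P i) F i) = \sum_(i <- r | P i) dotp a (F i).
Proof.
rewrite dotpE mulmx_suml summxE; apply: eq_bigr => i _.
by rewrite dotpE.
Qed.

Lemma dotp_ge0 a : 0 <= dotp a a.
Proof. by apply: sumr_ge0 => i _; rewrite -expr2 sqr_ge0. Qed.

Lemma dotp_eq0 a : dotp a a = 0 -> a = 0.
Proof.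
move=> /eqP; rewrite psumr_eq0 => [/allP a0|i _]; last by rewrite -expr2 sqr_ge0.
apply/rowP => i; have := a0 i; rewrite mem_index_enum -expr2 sqrf_eq0 mxE.
by move=> /(_ isT)/eqP.
Qed.

(* Bartl's induction on the number of inequalities: a direction x0 violating
   the conclusion without the last inequality serves to project it away. *)
Lemma farkas n (w : nat -> 'rV[R]_d) b :
  (forall x, (forall i, (i < n)%N -> dotp (w i) x <= 0) -> dotp b x <= 0) ->
  exists u : nat -> R,
    (forall i, 0 <= u i) /\ b = \sum_(i < n) u i *: w i.
Proof.
elim: n w b => [|n IHn] w b wb.
  exists (fun=> 0); split=> //; rewrite big_ord0; apply: dotp_eq0.
  by apply/eqP; rewrite eq_le dotp_ge0 wb.
have [wb'|] := pselect (forall x,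
    (forall i, (i < n)%N -> dotp (w i) x <= 0) -> dotp b x <= 0).
  have [u [u0 ->]] := IHn _ _ wb'.
  exists (fun i => if i == n then 0 else u i); split=> [i|]; first by case: eqP.
  rewrite big_ord_recr /= eqxx scale0r addr0; apply: eq_bigr => i _.
  by rewrite ltn_eqF.
move=> /existsNP[x0 /not_implyP[wx0 /negP]]; rewrite -ltNge => bx0.
have wn0 : 0 < dotp (w n) x0.
  rewrite ltNge; apply: contraL bx0 => wn0; rewrite -leNgt; apply: wb => i.
  by rewrite ltnS leq_eqVlt => /orP[/eqP->//|/wx0].
(* [y - q y *: w n] is the projection of y along [w n] onto the vectors orthogonal to [x0]. *)
pose q y := dotp y x0 / dotp (w n) x0.
have [|u [u0 bE]] := IHn (fun i => w i - q (w i) *: w n) (b - q b *: w n).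
  move=> x wx.
  (* The adjoint view: x is moved along [x0] until it is orthogonal to [w n], so that the last
     inequality becomes an equality. *)
  have proj y : dotp (y - q y *: w n) x
      = dotp y (x - (dotp (w n) x / dotp (w n) x0) *: x0).
    rewrite dotpBl dotpBr dotpZl dotpZr /q; congr (_ - _).
    by rewrite mulrAC [RHS]mulrC mulrA.
  rewrite proj; apply: wb => i; rewrite ltnS leq_eqVlt => /orP[/eqP->|ltin].
    by rewrite dotpBr dotpZr divfK ?subrr// gt_eqF.
  by rewrite -proj wx.
(* The coefficient of [w n] collects what the projections removed. It is nonnegative because
   [q b > 0], whereas [q (w i) <= 0] for i < n. *)
exists (fun i => if i == n then q b - \sum_(i < n) u i * q (w i) else u i).
split=> [i|].
  case: eqP => // _; rewrite subr_ge0; apply: (@le_trans _ _ 0).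
    apply: sumr_le0 => j _; rewrite mulr_ge0_le0// /q.
    by rewrite mulr_le0_ge0 ?wx0// invr_ge0 ltW.
  by rewrite divr_ge0 // ltW.
rewrite big_ord_recr /= eqxx.
rewrite (eq_bigr (fun i : 'I_n => u i *: w i)) => [|i _]; last by rewrite ltn_eqF.
rewrite -[LHS](subrK (q b *: w n)) bE scalerBl.
rewrite (eq_bigr (fun i : 'I_n => u i *: w i - (u i * q (w i)) *: w n)); last first.
  by move=> i _; rewrite scalerBr scalerA.
by rewrite sumrB -scaler_suml addrAC -addrA.
Qed.

(** By Farkas each [- w k] is a nonnegative combination of the [w i]. Adding [w k] gives a relation
    with positive coefficient at k, and the sum of these relations over k is positive everywhere. *)
Lemma stiemke n (w : nat -> 'rV[R]_d) :
  (forall x, (forall i, (i < n)%N -> dotp (w i) x <= 0) ->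
     forall i, (i < n)%N -> dotp (w i) x = 0) ->
  exists u : nat -> R,
    (forall i, 0 < u i) /\ \sum_(i < n) u i *: w i = 0.
Proof.
move=> w0.
have /choice[U U_] k : exists u : nat -> R, (k < n)%N ->
    (forall i, 0 <= u i) /\ - w k = \sum_(i < n) u i *: w i.
  have [ltkn|] := boolP (k < n)%N; last by exists (fun=> 0).
  have [|u uP] := @farkas n w (- w k); last by exists u.
  by move=> x /w0 /(_ _ ltkn) wk; rewrite dotpNl wk oppr0.
exists (fun i => 1 + \sum_(k < n) U k i); split=> [i|].
  by rewrite ltr_pwDl// sumr_ge0// => k _; have [->] := U_ _ (ltn_ord k).
rewrite (eq_bigr (fun i : 'I_n => w i + \sum_(k < n) U k i *: w i)); last first.
  by move=> i _; rewrite scalerDl scale1r scaler_suml.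
rewrite big_split /= exchange_big /= -big_split /= big1// => k _.
by have [_ <-] := U_ _ (ltn_ord k); rewrite subrr.
Qed.

End LinearInequalities.

(** * Convex weights, interior points and supporting hyperplanes *)

Section Polytopes.
Context {R : realType} {d : nat}.
Implicit Types (V F : seq 'rV[R]_d) (a x y v : 'rV[R]_d) (f g : 'rV[R]_d -> R).

(** Weights are attached to points rather than positions, so that passing to a face needs no
    reindexing; values outside V are irrelevant. *)
Definition bary V f x : Prop :=
  [/\ {in V, forall v, 0 <= f v}, \sum_(v <- V) f v = 1 &
      x = \sum_(v <- V) f v *: v].

Lemma bary_vertex V v : uniq V -> v \in V -> bary V (fun u => (u == v)%:R) v.
Proof.
move=> uV vV; split=> [u _||]; first by rewrite ler0n.
- by rewrite (bigD1_seq v)//= eqxx big1 ?addr0// => u /negPf->.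
- rewrite (bigD1_seq v)//= eqxx scale1r big1 ?addr0// => u /negPf->.
  by rewrite scale0r.
Qed.

Lemma bary_midpoint V f g x y : bary V f x -> bary V g y ->
  bary V (fun v => (f v + g v) / 2) (2^-1 *: (x + y)).
Proof.
move=> [f0 f1 fx] [g0 g1 gx]; split=> [v vV||].
- by rewrite divr_ge0// addr_ge0// ?f0 ?g0.
- by rewrite -mulr_suml big_split/= f1 g1 divff.
- rewrite fx gx -big_split/= scaler_sumr; apply: eq_bigr => v _.
  by rewrite -scalerDl scalerA mulrC.
Qed.

Lemma dotp_bary V f x a : bary V f x -> dotp a x = \sum_(v <- V) f v * dotp a v.
Proof. by move=> [_ _ ->]; rewrite dotp_sumr; apply: eq_bigr => v _; rewrite dotpZr. Qed.

(** The slack [b - dotp a x = 0] is the sum of the nonnegative terms [f v * (b - dotp a v)], so each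
    of them vanishes. *)
Lemma bary_support V f x a b : bary V f x ->
  {in V, forall v, dotp a v <= b} -> dotp a x = b ->
  {in V, forall v, dotp a v != b -> f v = 0}.
Proof.
move=> fx aV ax; have [f0 f1 _] := fx.
have : \sum_(v <- V) f v * (b - dotp a v) = 0.
  under eq_bigr do rewrite mulrBr.
  by rewrite sumrB -mulr_suml f1 mul1r -(dotp_bary _ _ _ _ fx) ax subrr.
rewrite big_seq => /eqP; rewrite psumr_eq0; last first.
  by move=> v vV; rewrite mulr_ge0 ?f0// subr_ge0 aV.
move=> /allP s0 v vV avb; have := s0 v vV; rewrite vV /= mulf_eq0 subr_eq0.
by rewrite [b == _]eq_sym (negPf avb) orbF => /eqP.
Qed.

Lemma aff_rank_full V : aff_rank V = d ->
  exists B : 'M[R]_(d, size V), forall z : 'rV[R]_d,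
    z = \sum_(i < size V) (z *m B) ord0 i *: (V`_i - V`_0).
Proof.
move=> Vd; have /row_fullP[B BM] : row_full (\matrix_(i < size V) (V`_i - V`_0)).
  exact/eqP.
exists B => z; rewrite -{1}[z]mulmx1 -BM mulmxA mulmx_sum_row.
by apply: eq_bigr => i _; rewrite rowK.
Qed.

Lemma dotp_const_eq0 V a b : aff_rank V = d ->
  {in V, forall v, dotp a v = b} -> a = 0.
Proof.
move=> /aff_rank_full[B BV] aV; apply: dotp_eq0; rewrite {2}[a]BV dotp_sumr.
rewrite big1// => i _; rewrite dotpZr dotpBr !aV ?subrr ?mulr0 ?mem_nth//.
exact: leq_ltn_trans (ltn_ord i).
Qed.

Lemma pos_lower_bound V f : {in V, forall v, 0 < f v} ->
  exists2 m, 0 < m & {in V, forall v, m <= f v}.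
Proof.
elim: V => [_|u V IHV fV]; first by exists 1.
have [|m m0 mV] := IHV; first by move=> v vV; rewrite fV// inE vV orbT.
exists (Num.min m (f u)); first by rewrite lt_min m0 fV ?mem_head.
move=> v; rewrite inE => /orP[/eqP->|/mV mv]; first by rewrite ge_min lexx orbT.
by rewrite ge_min mv.
Qed.

(** A displacement [y - x] has coordinates on the edges from the first vertex that depend linearly
    on it, hence are small; weights bounded below by m > 0 can absorb them. *)
Lemma bary_pos_interior V f x : V != [::] -> aff_rank V = d ->
  bary V f x -> {in V, forall v, 0 < f v} -> (conv_hull V)° x.
Proof.
move=> V0 /aff_rank_full[B BV] [_ f1 fx] /pos_lower_bound[m m0 mV].
pose C := \sum_(i < size V) \sum_j `|B j i|.
have C0 : 0 <= C by apply: sumr_ge0 => i _; apply: sumr_ge0.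
have e0 : 0 < m / (2 * C + 1).
  by rewrite divr_gt0// ltr_wpDl// mulr_ge0.
(* For this radius r, a weight changes by at most 2 r C <= m: once by its coordinate and, at the
   first vertex, once more by the sum of all coordinates. The added 1 covers C = 0. *)
apply/nbhs_ballP; exists (m / (2 * C + 1)) => //= y [_ xy].
set c := (y - x) *m B.
have cE i : `|c ord0 i| <= m / (2 * C + 1) * \sum_j `|B j i|.
  rewrite /c mxE mulr_sumr; apply: le_trans (ler_norm_sum _ _ _) _.
  apply: ler_sum => j _; rewrite normrM ler_wpM2r//.
  by rewrite !mxE distrC ltW//; apply: xy.
have cC : \sum_i `|c ord0 i| <= m / (2 * C + 1) * C.
  by rewrite /C mulr_sumr; apply: ler_sum => i _.
have mC : m / (2 * C + 1) * C * 2 <= m.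
  rewrite -mulrA mulrAC ler_pdivrMr; last by rewrite ltr_wpDl// mulr_ge0.
  by rewrite ler_wpM2l 1?ltW//; lra.
have sV : (0 < size V)%N by rewrite lt0n size_eq0.
pose s := \sum_i c ord0 i.
pose i0 := Ordinal sV.
(* The edges start at the first vertex, which therefore gives up s; this keeps the total weight
   equal to 1. *)
exists (fun i : 'I_(size V) => f V`_i + c ord0 i - (i == i0)%:R * s); split=> [i||].
- have fi : m <= f V`_i by rewrite mV// mem_nth.
  have ci : `|c ord0 i| <= m / (2 * C + 1) * C.
    by apply: le_trans cC; rewrite (bigD1 i)//= lerDl sumr_ge0.
  have si : `|s| <= m / (2 * C + 1) * C := le_trans (ler_norm_sum _ _ _) cC.
  have {}si : (i == i0)%:R * s <= m / (2 * C + 1) * C.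
    have := ler_norm s; have := normr_ge0 s; case: eqP => _; rewrite ?mul1r ?mul0r; lra.
  by move: ci; rewrite ler_norml => /andP[]; lra.
- have {}f1 : \sum_(i < size V) f V`_i = 1 by rewrite -f1 (big_nth 0) big_mkord.
  have i0E : \sum_(i < size V) (i == i0)%:R = 1 :> R.
    by rewrite (bigD1 i0)//= big1 ?addr0// => i /negPf->.
  by rewrite sumrB big_split/= -mulr_suml f1 i0E mul1r addrK.
- rewrite -[LHS](subrK x) [X in X + _]BV -/c addrC.
  have -> : x = \sum_(i < size V) f V`_i *: V`_i.
    by rewrite [LHS]fx (big_nth 0) big_mkord.
  rewrite -big_split /=.
  rewrite [RHS](eq_bigr (fun i : 'I_(size V) => f V`_i *: V`_i + c ord0 i *: V`_i
     - ((i == i0)%:R * s) *: V`_i)); last first.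
    by move=> i _; rewrite scalerBl scalerDl.
  rewrite [RHS]sumrB.
  have -> : \sum_(i < size V) ((i == i0)%:R * s) *: V`_i = s *: V`_0.
    rewrite (bigD1 i0)//= mul1r big1 ?addr0// => i /negPf->.
    by rewrite mul0r scale0r.
  rewrite /s scaler_suml -sumrB; apply: eq_bigr => i _.
  by rewrite scalerBr addrA.
Qed.

(** Without such a normal, Stiemke applied to the vectors v - x yields a positive relation.
    Normalized, it writes x with all weights positive, so x is interior. *)
Lemma supporting_hyperplane V x : uniq V -> V != [::] -> aff_rank V = d ->
  ~ (conv_hull V)° x ->
  exists2 a, a != 0 & {in V, forall v, dotp a v <= dotp a x}.
Proof.
move=> uV V0 Vd nx; apply: contrapT => na; apply: nx.
have [|u [u0 ux]] := stiemke (size V) (fun i => V`_i - x).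
  move=> a aV i iV; have [->|an0] := eqVneq a 0.
    by rewrite dotpC -(scale0r 0) dotpZl mul0r.
  case: na; exists a => // v vV; rewrite -subr_le0 -dotpBr dotpC.
  by rewrite -(nth_index 0 vV) aV// index_mem.
pose s := \sum_(i < size V) u i.
have s0 : 0 < s.
  have sV : (0 < size V)%N by rewrite lt0n size_eq0.
  by rewrite /s (bigD1 (Ordinal sV))//= ltr_pwDl// sumr_ge0// => i _; rewrite ltW.
apply: (bary_pos_interior V (fun v => u (index v V) / s)) => //; last first.
  by move=> v vV; rewrite divr_gt0.
have bV (T : nmodType) (F : R -> 'rV[R]_d -> T) :
    \sum_(v <- V) F (u (index v V)) v = \sum_(i < size V) F (u i) V`_i.
  by rewrite (big_nth 0) big_mkord; apply: eq_bigr => i _; rewrite index_uniq.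
split=> [v vV||]; first by rewrite divr_ge0// ltW.
  by rewrite -mulr_suml (bV _ (fun r _ => r)) divff// gt_eqF.
rewrite (bV _ (fun r v => (r / s) *: v)); move: ux.
under eq_bigr do rewrite scalerBr.
rewrite sumrB -scaler_suml -/s => /subr0_eq usx.
apply: (scalerI (lt0r_neq0 s0)); rewrite -usx scaler_sumr.
by apply: eq_bigr => i _; rewrite scalerA mulrCA divff ?mulr1// gt_eqF.
Qed.
End Polytopes.

(** * Facets, and uniqueness of weights on the boundary *)

Section Facets.
Context {R : realType} {d : nat}.
Implicit Types (V F : seq 'rV[R]_d) (a c x y v : 'rV[R]_d) (f g : 'rV[R]_d -> R).

Lemma dotp_bary_face V f x a c k : bary V f x ->
  {in V, forall v, dotp a v <= dotp a x} ->
  {in [seq v <- V | dotp a v == dotp a x], forall v, dotp c v = k} ->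
  dotp c x = k.
Proof.
move=> fx aV cF; rewrite (dotp_bary _ _ _ _ fx) big_seq.
transitivity (\sum_(v <- V | v \in V) f v * k).
  apply: eq_bigr => v vV.
  have [av|av] := eqVneq (dotp a v) (dotp a x).
    by rewrite cF// mem_filter av eqxx.
  by rewrite (bary_support _ _ _ _ _ fx aV erefl _ vV av) !mul0r.
by rewrite -big_seq -mulr_suml; have [_ -> _] := fx; rewrite mul1r.
Qed.

Lemma face_neq_nil V f x a : bary V f x ->
  {in V, forall v, dotp a v <= dotp a x} ->
  [seq v <- V | dotp a v == dotp a x] != [::].
Proof.
move=> fx aV; apply/eqP => F0.
(* On an empty face [dotp a] takes every constant value vacuously, including this absurd one. *)
have /eqP : dotp a x = dotp a x + 1.
  by apply: (dotp_bary_face V f x a a _ fx aV) => v; rewrite F0.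
by rewrite -subr_eq0 opprD addrA subrr sub0r oppr_eq0 oner_eq0.
Qed.

Lemma aff_rank_hyperplane F a b : a != 0 -> F != [::] ->
  {in F, forall v, dotp a v = b} -> (aff_rank F <= d.-1)%N.
Proof.
move=> a0 F0 aF; set N := \matrix_(i < size F) (F`_i - F`_0).
have : N *m a^T = 0.
  apply/row_matrixP => i; rewrite row_mul rowK row0; apply/rowP => j.
  rewrite !ord1 -dotpE mxE dotpBr !aF ?subrr ?mem_nth//.
  by rewrite lt0n size_eq0.
move=> /mulmx0_rank_max; rewrite mxrank_tr rank_rV a0 addn1 => rN.
by rewrite -ltnS (leq_trans rN)// leqSpred.
Qed.

(** The vectors orthogonal to all differences in F form a space of dimension [d - aff_rank F], at
    least 2, too large for the line of a. *)
Lemma face_normal F a : aff_rank F != d.-1 -> (aff_rank F <= d.-1)%N ->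
  exists2 c, ~~ (c <= a)%MS & {in F, forall v, dotp c v = dotp c F`_0}.
Proof.
set N := \matrix_(i < size F) (F`_i - F`_0) => rN rN'.
have /row_subPn[i ca] : ~~ (kermx N^T <= a)%MS.
  apply/negP => /mxrankS; rewrite mxrank_ker mxrank_tr.
  have {rN rN'} : (\rank N < d.-1)%N by rewrite ltn_neqAle rN.
  move=> rN /leq_trans/(_ (rank_leq_row _)); apply/negP; rewrite -ltnNge.
  by rewrite ltn_subRL addn1 -ltn_predRL.
exists (row i (kermx N^T)) => // v vF.
have /sub_kermxP cN := row_sub i (kermx N^T).
have ltv : (index v F < size F)%N by rewrite index_mem.
apply/eqP; rewrite -subr_eq0 -dotpBr dotpC dotpE.
have -> : v - F`_0 = row (Ordinal ltv) N by rewrite rowK nth_index.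
set c := row i _ in cN *.
suff -> : c *m (row (Ordinal ltv) N)^T = 0 by rewrite mxE.
by rewrite tr_row colE mulmxA cN mul0mx.
Qed.


(* Tilt a about the affine span of the face, in a direction c constant on that
   face and independent of a, until a further vertex is hit. *)
Lemma tilt_hyperplane V f x a : uniq V -> aff_rank V = d -> bary V f x ->
  a != 0 -> {in V, forall v, dotp a v <= dotp a x} ->
  aff_rank [seq v <- V | dotp a v == dotp a x] != d.-1 ->
  exists a', [/\ a' != 0, {in V, forall v, dotp a' v <= dotp a' x} &
    (size [seq v <- V | dotp a v == dotp a x] <
     size [seq v <- V | dotp a' v == dotp a' x])%N].
Proof.
set F := [seq v <- V | _] => uV Vd fx a0 aV rF.
have F0 : F != [::] by apply: face_neq_nil fx aV.
have [|c ca cF] := face_normal F a rF.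
  by apply: (aff_rank_hyperplane F a (dotp a x)) => // v; rewrite mem_filter => /andP[/eqP].
have cx : dotp c x = dotp c F`_0 by exact: dotp_bary_face fx aV cF.
(* Up to sign, c exceeds its value at x on some vertex. Otherwise c is constant on V, hence 0 by
   full dimension, and not independent of a. *)
have {c ca cF cx F0} [c [ca cF [v1 v1V v1c]]] : exists c, [/\ ~~ (c <= a)%MS,
    {in F, forall v, dotp c v = dotp c x} &
    exists2 v, v \in V & dotp c x < dotp c v].
  have cFx v : v \in F -> dotp c v = dotp c x by move=> vF; rewrite cx cF.
  have [[v vV cv]|nc] := pselect (exists2 v, v \in V & dotp c x < dotp c v).
    by exists c; split=> //; exists v.
  have [[v vV cv]|nc'] := pselect (exists2 v, v \in V & dotp c v < dotp c x).
    exists (- c); rewrite eqmx_opp; split=> // [u uF|]; first by rewrite !dotpNl cFx.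
    by exists v => //; rewrite !dotpNl ltrN2.
  case/negP: ca; rewrite (dotp_const_eq0 V c (dotp c x)) ?sub0mx// => v vV.
  apply/eqP; rewrite eq_le !leNgt; apply/andP; split; apply/negP => cv.
    by apply: nc; exists v.
  by apply: nc'; exists v.
(* [a + t *: c] still supports at x as long as [t * p v <= q v] on V, so t will be the least ratio
   [q v / p v] over the v with [0 < p v]. *)
pose p v := dotp c v - dotp c x.
pose q v := dotp a x - dotp a v.
have q0 v : v \in V -> 0 <= q v by move=> vV; rewrite subr_ge0 aV.
have [v0 [v0V pv0 v0min]] : exists v0, [/\ v0 \in V, 0 < p v0 &
    {in V, forall v, 0 < p v -> q v0 / p v0 <= q v / p v}].
  have lt1 : (index v1 V < size V)%N by rewrite index_mem.
  have [|i pi imin] := @Order.TotalTheory.arg_minP _ _ _ (Ordinal lt1)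
      (fun i => 0 < p V`_i) (fun i => q V`_i / p V`_i).
    by rewrite /= nth_index// subr_gt0.
  exists V`_i; split=> // [|v vV pv]; first exact: mem_nth.
  have ltv : (index v V < size V)%N by rewrite index_mem.
  by have := imin (Ordinal ltv); rewrite /= nth_index//; apply.
set t := q v0 / p v0 in v0min.
have t0 : 0 <= t by rewrite divr_ge0 ?q0// ltW.
have tE v : dotp (a + t *: c) v = dotp (a + t *: c) x + (t * p v - q v).
  rewrite !dotpDl !dotpZl /p /q; lra.
exists (a + t *: c); split=> [|v vV|].
- apply: contra ca => /eqP atc; have [tz|tn] := eqVneq t 0.
    by move: atc a0; rewrite tz scale0r addr0 => ->; rewrite eqxx.
  have -> : c = (- t^-1) *: a.
    apply: (scalerI tn); rewrite scalerA mulrN divff// scaleN1r.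
    by apply/eqP; rewrite -addr_eq0 addrC atc.
  exact: scalemx_sub.
- rewrite tE gerDl subr_le0; have [pv|pv] := ltP 0 (p v).
    by rewrite -ler_pdivlMr// v0min.
  by apply: (@le_trans _ _ 0); rewrite ?q0// mulr_ge0_le0.
(* The new face contains F, where p and q vanish, and also [v0], which is outside F because
   [0 < p v0]. *)
- apply: (@uniq_leq_size _ (v0 :: F)) => [/=|v].
    rewrite filter_uniq// andbT; apply/negP => /cF cv0.
    by move: pv0; rewrite /p cv0 subrr ltxx.
  rewrite inE => /orP[/eqP->|vF];
    rewrite mem_filter tE -[X in _ == X]addr0 (inj_eq (addrI _)).
    by rewrite v0V andbT /t divfK ?subrr// gt_eqF.
  rewrite /p cF// subrr mulr0 sub0r oppr_eq0 /q.
  by move: vF; rewrite mem_filter => /andP[/eqP-> ->]; rewrite subrr eqxx.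
Qed.

(** Induction on the number of vertices off the face: each tilt lowers it, until the face has full
    rank [d.-1]. *)
Lemma facet_through V f x a : uniq V -> aff_rank V = d -> bary V f x ->
  a != 0 -> {in V, forall v, dotp a v <= dotp a x} ->
  exists2 a', {in V, forall v, dotp a' v <= dotp a' x} &
    facet_vertices V [seq v <- V | dotp a' v == dotp a' x].
Proof.
move=> uV Vd fx.
have [n] := ubnP (size V - size [seq v <- V | dotp a v == dotp a x]).
elim: n a => // n IHn a; rewrite ltnS => an a0 aV.
have [rF|rF] := eqVneq (aff_rank [seq v <- V | dotp a v == dotp a x]) d.-1.
  exists a => //; exists a, (dotp a x); split=> //.
  exact: face_neq_nil fx aV.
have [a' [a'0 a'V a'lt]] := tilt_hyperplane V f x a uV Vd fx a0 aV rF.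
apply: (IHn a') => //; apply: leq_trans an; rewrite ltn_sub2l//.
by apply: leq_trans a'lt _; rewrite size_filter count_size.
Qed.

(** Row 0 of the difference matrix is zero, and independence makes the left kernel a line, spanned
    by the first unit vector. So f is concentrated on the first point, where its zero sum kills
    it. *)
Lemma aff_indep_eq0 F f : aff_indep F ->
  \sum_(v <- F) f v = 0 -> \sum_(v <- F) f v *: v = 0 ->
  {in F, forall v, f v = 0}.
Proof.
move=> [F0 rF] f0 fv0; have sF : (0 < size F)%N by rewrite lt0n size_eq0.
pose i0 := Ordinal sF; pose c := \row_(i < size F) f F`_i.
move: rF; rewrite /aff_rank; set N := \matrix_(i < size F) (F`_i - F`_0) => rN.
have cN : c *m N = 0.
  rewrite mulmx_sum_row; under eq_bigr do rewrite rowK mxE scalerBr.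
  rewrite sumrB -scaler_suml.
  have -> : \sum_(i < size F) f F`_i = 0 by rewrite -[RHS]f0 (big_nth 0) big_mkord.
  by rewrite scale0r subr0 -[RHS]fv0 [RHS](big_nth 0) big_mkord.
pose e : 'rV[R]_(size F) := delta_mx 0 i0.
have eN : e *m N = 0 by rewrite -rowE rowK subrr.
have eK : (e <= kermx N)%MS by apply/sub_kermxP.
have Ke : (kermx N <= e)%MS.
  rewrite -(geq_leqif (mxrank_leqif_sup eK)) mxrank_delta mxrank_ker rN.
  by rewrite -subn1 subKn.
have /sub_rVP[k ck] : (c <= e)%MS.
  by apply: submx_trans Ke; apply/sub_kermxP.
have fE (i : 'I_(size F)) : f F`_i = k * (i == i0)%:R.
  by have := congr1 (fun r : 'rV_(size F) => r 0 i) ck; rewrite !mxE eqxx.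
have k0 : k = 0.
  rewrite -f0 (big_nth 0) big_mkord (bigD1 i0)//= (fE i0) eqxx mulr1.
  by rewrite big1 ?addr0// => i /negPf ii0; rewrite fE ii0 mulr0.
move=> v vF; have ltv : (index v F < size F)%N by rewrite index_mem.
by rewrite -(nth_index 0 vF) (fE (Ordinal ltv)) k0 mul0r.
Qed.

(** Both weights vanish off a facet through x, and [f - g] is an affine relation among the vertices
    of that simplex. *)
Lemma bary_unique V f g x : uniq V -> V != [::] -> aff_rank V = d ->
  simplicial V -> ~ (conv_hull V)° x ->
  bary V f x -> bary V g x -> {in V, f =1 g}.
Proof.
move=> uV V0 Vd simV nx fx gx.
have [a0 a00 a0V] := supporting_hyperplane V x uV V0 Vd nx.
have [a aV /simV aF] := facet_through V f x a0 uV Vd fx a00 a0V.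
have f0 := bary_support _ _ _ _ _ fx aV erefl.
have g0 := bary_support _ _ _ _ _ gx aV erefl.
have [_ f1 fE] := fx; have [_ g1 gE] := gx.
move=> v vV; have [av|av] := eqVneq (dotp a v) (dotp a x); last by rewrite f0 ?g0.
apply/eqP; rewrite -subr_eq0; apply/eqP.
have restr (T : nmodType) (h : 'rV[R]_d -> T) :
    {in V, forall u, dotp a u != dotp a x -> h u = 0} ->
    \sum_(u <- [seq u <- V | dotp a u == dotp a x]) h u = \sum_(u <- V) h u.
  move=> h0; rewrite big_filter [RHS](bigID (fun u => dotp a u == dotp a x))/=.
  rewrite [X in _ = _ + X]big_seq_cond [X in _ = _ + X]big1 ?addr0// => u /andP[].
  exact: h0.
apply: (aff_indep_eq0 _ (fun u => f u - g u) aF); last by rewrite mem_filter av eqxx.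
  rewrite restr => [|u uV' au]; first by rewrite sumrB f1 g1 subrr.
  by rewrite f0// g0// subrr.
rewrite restr => [|u uV' au]; last by rewrite f0// g0// subrr scale0r.
by under eq_bigr do rewrite scalerBl; rewrite sumrB -fE -gE subrr.
Qed.

End Facets.

(** * Lattice points and the count of parity classes *)

Section LatticePoints.
Context {R : realType} {d : nat}.
Implicit Types (V : seq 'rV[R]_d) (x y v : 'rV[R]_d) (f g : 'rV[R]_d -> R).

(** On lattice points this is the class modulo 2; the floor only makes it total. *)
Definition parity x : {ffun 'I_d -> bool} :=
  [ffun j => (Num.floor (x ord0 j) %% 2)%Z == 0].

Lemma lattice_midpoint x y : lattice_pt x -> lattice_pt y ->
  parity x = parity y -> lattice_pt (2^-1 *: (x + y)).
Proof.
move=> lx ly pxy j; have := congr1 (fun p : {ffun 'I_d -> bool} => p j) pxy.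
rewrite !ffunE !mxE; have /intrP[m ->] := lx j; have /intrP[n ->] := ly j.
rewrite !intrKfloor => mn.
have -> : 2^-1 * (m%:~R + n%:~R) = ((m + n) %/ 2)%Z%:~R :> R.
  have mnE : m + n = ((m + n) %/ 2)%Z * 2 by lia.
  rewrite -intrD {1}mnE intrM mulrC mulfK//.
exact: intr_int.
Qed.

Lemma finitely_many_lattice_pts V : exists (T : finType) (e : T -> 'rV[R]_d),
  forall f x, bary V f x -> lattice_pt x -> exists t, x = e t.
Proof.
pose C : R := \sum_(v <- V) \sum_j `|v ord0 j|.
pose N := Num.bound C.
(* The finite type codes the integer points of the box [-N, N]^d, shifted by N. Weights are at most
   1, so C bounds every coordinate. *)
exists 'rV['I_(N + N).+1]_d, (fun t : 'rV['I_(N + N).+1]_d => \row_j ((t ord0 j)%:R - N%:R)).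
move=> f x fx lx.
have xC j : `|x ord0 j| <= C.
  have [f0 f1 xE] := fx.
  have {1}-> : x ord0 j = \sum_(v <- V) f v * v ord0 j.
    by rewrite {1}xE summxE; apply: eq_bigr => v _; rewrite mxE.
  apply: le_trans (ler_norm_sum _ _ _) _.
  rewrite [leLHS]big_seq [leRHS]big_seq; apply: ler_sum => v vV.
  rewrite normrM ger0_norm ?f0//.
  have fv1 : f v <= 1.
    rewrite -f1 (big_rem v)//= lerDl big_seq sumr_ge0// => u /mem_rem.
    exact: f0.
  apply: (@le_trans _ _ (1 * `|v ord0 j|)); first by rewrite ler_wpM2r.
  by rewrite mul1r (bigD1 j)//= lerDl sumr_ge0.
have CN : C < N%:R by rewrite archi_boundP// sumr_ge0// => v _; rewrite sumr_ge0.
exists (\row_j inord (Num.truncn (x ord0 j + N%:R))); apply/rowP => j; rewrite !mxE.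
have /natrP[k kE] : x ord0 j + N%:R \is a Num.nat.
  rewrite natrEint rpredD ?lx ?rpred_nat//=.
  by have := xC j; rewrite ler_norml => /andP[]; lra.
rewrite kE natrK inordK; first by rewrite -kE addrK.
rewrite ltnS -(ler_nat R) -kE natrD.
by have := xC j; rewrite ler_norml => /andP[]; lra.
Qed.

(** The candidates for p_i when v is v_i; the vertices are ordered as in the list V. *)
Definition last_supported V v f x : Prop :=
  [/\ lattice_pt x, bary V f x, 0 < f v &
      {in V, forall u, (index v V < index u V)%N -> f u = 0}].

Lemma last_supported_min V v : uniq V -> (forall u, u \in V -> lattice_pt u) ->
  (forall f g x, lattice_pt x -> bary V f x -> bary V g x -> {in V, f =1 g}) ->
  v \in V ->
  exists f x, last_supported V v f x /\
    forall g y, last_supported V v g y -> f v <= g v.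
Proof.
move=> uV lV unV vV; have [T [e eP]] := finitely_many_lattice_pts V.
(* One weight function is fixed per candidate point; by uniqueness its value at v is that of any
   other, so minimizing over the finite type suffices. *)
have /choice[W WP] t : exists f,
    (exists g, last_supported V v g (e t)) -> last_supported V v f (e t).
  have [[g gt]|ng] := pselect (exists g, last_supported V v g (e t)); first by exists g.
  by exists (fun=> 0).
pose P t := `[< exists g, last_supported V v g (e t) >].
have tv : last_supported V v (fun u => (u == v)%:R) v.
  split; [exact: lV|exact: bary_vertex|by rewrite eqxx ltr01|].
  by move=> u uV' lt; case: eqP => // uv; rewrite uv ltnn in lt.
have toT g y : last_supported V v g y -> exists t, [/\ y = e t, P t & W t v = g v].
  move=> gy; have [ly by_ _ _] := gy.
  have [t tE] := eP _ _ by_ ly; subst y; exists t; split=> //.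
    by apply/asboolP; exists g.
  have [_ bW _ _] := WP t (ex_intro _ g gy).
  exact: (unV _ _ _ ly bW by_).
have [t0 [_ Pt0 _]] := toT _ _ tv.
have [t /asboolP Pt tmin] := @Order.TotalTheory.arg_minP _ _ _ t0 P (fun t => W t v) Pt0.
exists (W t), (e t); split; first exact: WP.
by move=> g y /toT[s [_ Ps <-]]; exact: tmin.
Qed.

Lemma size_unique_bary V : uniq V -> (forall v, v \in V -> lattice_pt v) ->
  (forall f g x, lattice_pt x -> bary V f x -> bary V g x -> {in V, f =1 g}) ->
  (size V <= 2 ^ d)%N.
Proof.
move=> uV lV unV.
have /choice[W WP] v : exists fx : ('rV[R]_d -> R) * 'rV[R]_d, v \in V ->
    last_supported V v fx.1 fx.2 /\
    forall g y, last_supported V v g y -> fx.1 v <= g v.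
  have [vV|_] := boolP (v \in V); last by exists (fun=> 0, 0).
  by have [f [x fx]] := last_supported_min V v uV lV unV vV; exists (f, x).
have parity_neq u v : u \in V -> v \in V -> (index u V < index v V)%N ->
    parity (W u).2 <> parity (W v).2.
  move=> uV' vV uv puv; have [[lu bu _ topu] _] := WP _ uV'.
  have [[lv bv posv topv] minv] := WP _ vV.
  have /minv : last_supported V v (fun w => ((W u).1 w + (W v).1 w) / 2)
      (2^-1 *: ((W u).2 + (W v).2)).
    split; [exact: lattice_midpoint|exact: bary_midpoint| |].
      by rewrite topu//; lra.
    by move=> w wV vw; rewrite topu ?(ltn_trans uv)// topv// addr0 mul0r.
  (* Minimality at v now says that a positive weight is at most its half. *)
  by rewrite /= topu//; lra.
have <- : #|{ffun 'I_d -> bool}| = (2 ^ d)%N by rewrite card_ffun card_bool card_ord.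
rewrite -(size_map (fun v => parity (W v).2) V).
have uP : uniq [seq parity (W v).2 | v <- V].
  rewrite map_inj_in_uniq// => u v uV' vV puv.
  case: (ltngtP (index u V) (index v V)) => [uv|vu|].
  - by case: (parity_neq u v).
  - by case: (parity_neq v u).
  - by move=> /(congr1 (nth 0 V)); rewrite !nth_index.
by rewrite -(card_uniqP uP) max_card.
Qed.

End LatticePoints.

Theorem theorem12 (R : realType) (d : nat) (V : seq 'rV[R]_d) :
  vertex_set V ->
  (forall v, v \in V -> lattice_pt v) ->
  V != [::] -> aff_rank V = d ->
  (forall x, (conv_hull V)° x -> ~ lattice_pt x) ->
  simplicial V ->
  (size V <= 2 ^ d)%N.
Proof.
move=> [uV _] lV V0 Vd hollowV simV; apply: size_unique_bary => // f g x lx.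
by apply: bary_unique => //; move=> /hollowV.
Qed.
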